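(* Let $x_1,x_2,x_3,x_4\in\mathbb{R}^3$ be the vertices of a cyclic quadrilateral, i.e. four distinct coplanar points lying on a common circle. Then the Atiyah determinant $\det M_4$ of $(x_1,x_2,x_3,x_4)$ satisfies $$|\det M_4|^2\;\geq\;\prod_{\{i<j<k\}\subset\{1,2,3,4\}}\big(d_3(r_{ij},r_{ik},r_{jk})+8\,r_{ij}r_{ik}r_{jk}\big).$$
   Context: For distinct points $x_1,\dots,x_4\in\mathbb{R}^3$ let $r_{ij}=|x_i-x_j|$ and $v_{ij}=(x_j-x_i)/|x_j-x_i|$ for $i\neq j$. Put $d_3(a,b,c)=(a+b-c)(b+c-a)(c+a-b)$. Atiyah determinant: for $(a,b)\in\mathbb{C}^2$ with $|a|^2+|b|^2=1$ associate the unit vector $(2\,\mathrm{Re}(a\bar b),\,2\,\mathrm{Im}(a\bar b),\,|a|^2-|b|^2)\in S^2$ (this realizes $\mathbb{CP}^1\cong S^2$ by stereographic projection, the point of the Riemann sphere being $t=a/b$). For $i<j$ choose a unit vector $(a_{ij},b_{ij})\in\mathbb{C}^2$ associated with $v_{ij}$ and put $(a_{ji},b_{ji})=(-\overline{b_{ij}},\,\overline{a_{ij}})$, which is associated with $v_{ji}=-v_{ij}$. For $1\le i\le 4$ let $$p_i(t)=\prod_{j\neq i}(b_{ij}t-a_{ij})=\sum_{m=1}^{4}d_{im}t^{m-1},$$ a polynomial with roots $t_{ij}=a_{ij}/b_{ij}$ (a root at $\infty$ if $b_{ij}=0$). The Atiyah determinant is $$\det M_4=\Big(\prod_{1\le i<j\le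 4}2r_{ij}\Big)\det(d_{im})_{1\le i,m\le 4},$$ which does not depend on the choices of the $(a_{ij},b_{ij})$. *)

(* Defs.v *)
From mathcomp Require Import all_boot all_order all_algebra.
From mathcomp Require Import complex.
From mathcomp Require Import reals.

Set Implicit Arguments.
Unset Strict Implicit.
Unset Printing Implicit Defensive.

Import Order.TTheory GRing.Theory Num.Theory ComplexField.Normc.

Local Open Scope ring_scope.
Local Open Scope complex_scope.

Section AtiyahDefs.
Variable R : realType.
Implicit Types (u v n c : 'rV[R]_3) (x : 'I_4 -> 'rV[R]_3).
Implicit Types (z w : R[i]) (a b : 'I_4 -> 'I_4 -> R[i]).

Definition dot u v : R := \sum_(k < 3) u 0 k * v 0 k.

(* The norm that MathComp-Analysis puts on row vectors is the sup norm. *)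
Definition enorm u : R := Num.sqrt (dot u u).

Definition dist x (i j : 'I_4) : R := enorm (x i - x j).

Definition dir x (i j : 'I_4) : 'rV[R]_3 := (enorm (x j - x i))^-1 *: (x j - x i).

Definition d3 (p q r : R) : R := (p + q - r) * (q + r - p) * (r + p - q).

(* The circle of centre c and radius rho in the plane through c orthogonal
   to n; points on a common circle are thus coplanar. *)
Definition on_circle c n (rho : R) (p : 'rV[R]_3) : Prop :=
  dot (p - c) n = 0 /\ enorm (p - c) = rho.

(* No cyclic order is imposed on the labels of the four vertices. *)
Definition cyclic_quadrilateral x : Prop :=
  injective x /\
  exists c n (rho : R),
    [/\ n != 0, 0 < rho & forall i, on_circle c n rho (x i)].

(* The unit vector (z, w) of C^2 is associated with the point v of the sphere;
   normc is the R-valued complex modulus. *)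
Definition associated z w v : Prop :=
  [/\ normc z ^+ 2 + normc w ^+ 2 = 1,
      v 0 (inord 0) = 2 * complex.Re (z * w^*),
      v 0 (inord 1) = 2 * complex.Im (z * w^*) &
      v 0 (inord 2) = normc z ^+ 2 - normc w ^+ 2].

(* The diagonal values a i i and b i i are irrelevant. *)
Definition atiyah_choice x a b : Prop :=
  forall i j : 'I_4, (i < j)%N ->
    [/\ associated (a i j) (b i j) (dir x i j),
        a j i = - (b i j)^* & b j i = (a i j)^*].

Definition atiyah_poly a b (i : 'I_4) : {poly R[i]} :=
  \prod_(j < 4 | j != i) (b i j *: 'X - (a i j)%:P).

Definition atiyah_det x a b : R[i] :=
  (\prod_(i < 4) \prod_(j < 4 | (i < j)%N) (2 * dist x i j))%:C *
  \det (\matrix_(i < 4, m < 4) (atiyah_poly a b i)`_m).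

End AtiyahDefs.

(* Main.v *)
Require Import Defs.
From mathcomp Require Import all_boot all_order all_algebra.
From mathcomp Require Import complex.
From mathcomp Require Import reals.
From mathcomp Require Import ring lra.

Set Implicit Arguments.
Unset Strict Implicit.
Unset Printing Implicit Defensive.

Import Order.TTheory GRing.Theory Num.Theory ComplexField.Normc.

Local Open Scope ring_scope.
Local Open Scope complex_scope.

(** The proof evaluates the determinant explicitly as a trigonometric sum and
    then compares it with the product of the four triangle terms.

    Reduction to the complex plane.  A unit spinor [(al, be)] associated with a
    unit normal of the plane of the points gives a complex coordinate
    [planar_coord] that is isometric on that plane.  In the unitary frame made
    of this spinor and its antipode, the spinor of a direction [v] of the plane
    has components [(tau * q, q)], where [tau] is the complex coordinate of [v]
    and [|q|^2 = 1/2] ([frame_coords]).  The change of frame acts on binary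
    cubic forms with determinant of modulus one ([det_cubic_basis]), so that
    [|det M_4|] is the product of the distances times the modulus of a
    determinant in the unit numbers [tau_ij] only ([det_atiyah_frame]).

    Evaluation on the circle.  Write the points as [rho * u_k ^ 2] with [u_k]
    on the upper half circle, sorted by decreasing real part.  Then
    [tau_ij = i * u_i * u_j] for [i < j], and the determinant is, up to a unit
    factor, [64 + q_0 w_0 + q_1 w_1 + q_2 w_2 + q_3 w_3]
    ([det4_concyclic]).  There is one term for each of the four triangles;
    if [A], [B] are its two angles that face sides of the quadrilateral,
    [q = 2 (cos A + cos B - cos (A + B) - 1)] and
    [w = 6 + 2 (cos A + cos B + cos (A + B))].

    The inequality.  By the sine rule [q = d3 (a, b, c) / (a b c)] for the sides
    [a, b, c] of the triangle, so the triangle term of the bound is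
    [a b c (8 + q)]; moreover [q >= 0], and [w >= 4 + q] since
    [cos (A + B) >= -1] ([arc_bounds]).  The inequality between the arithmetic
    and the geometric mean then gives
    [prod (8 + q_k) <= (64 + sum q_k w_k) ^ 2] ([prod_le_sqr]). *)

(** * Determinants of order four and binary cubic forms *)

Section Det4.
Variable F : comNzRingType.
Implicit Types (f : nat -> F) (t : F).

(** Rows are functions on [nat], so that exchanging two of them and evaluating
    an entry are both immediate; the formula is the Laplace expansion along
    the first two rows. *)
Definition det4 f0 f1 f2 f3 : F :=
    (f0 0 * f1 1 - f0 1 * f1 0) * (f2 2 * f3 3 - f2 3 * f3 2)
  - (f0 0 * f1 2 - f0 2 * f1 0) * (f2 1 * f3 3 - f2 3 * f3 1)
  + (f0 0 * f1 3 - f0 3 * f1 0) * (f2 1 * f3 2 - f2 2 * f3 1)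
  + (f0 1 * f1 2 - f0 2 * f1 1) * (f2 0 * f3 3 - f2 3 * f3 0)
  - (f0 1 * f1 3 - f0 3 * f1 1) * (f2 0 * f3 2 - f2 2 * f3 0)
  + (f0 2 * f1 3 - f0 3 * f1 2) * (f2 0 * f3 1 - f2 1 * f3 0).

Lemma det_mx44 (f : nat -> nat -> F) :
  \det (\matrix_(i < 4, j < 4) f i j) = det4 (f 0) (f 1) (f 2) (f 3).
Proof.
rewrite (expand_det_row _ ord0) !big_ord_recl big_ord0 /cofactor.
rewrite !(expand_det_row _ ord0) !big_ord_recl !big_ord0 /cofactor.
rewrite !(expand_det_row _ ord0) !big_ord_recl !big_ord0 /cofactor.
rewrite !det_mx11 !mxE /= /bump /=.
rewrite /det4.
ring.
Qed.

(** The coefficients of [('X + t1) ('X + t2) ('X + t3)], constant term first. *)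
Definition cubic_row t1 t2 t3 : nat -> F :=
  nth 0 [:: t1 * t2 * t3; t1 * t2 + t1 * t3 + t2 * t3; t1 + t2 + t3; 1].

Lemma det4_swap01 f0 f1 f2 f3 : det4 f1 f0 f2 f3 = - det4 f0 f1 f2 f3.
Proof. rewrite /det4; ring. Qed.

Lemma det4_swap12 f0 f1 f2 f3 : det4 f0 f2 f1 f3 = - det4 f0 f1 f2 f3.
Proof. rewrite /det4; ring. Qed.

Lemma det4_swap23 f0 f1 f2 f3 : det4 f0 f1 f3 f2 = - det4 f0 f1 f2 f3.
Proof. rewrite /det4; ring. Qed.

Lemma cubic_row_swap12 t1 t2 t3 : cubic_row t2 t1 t3 = cubic_row t1 t2 t3.
Proof. by rewrite /cubic_row; congr (nth 0 [:: _; _; _; _]); ring. Qed.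

Lemma cubic_row_swap23 t1 t2 t3 : cubic_row t1 t3 t2 = cubic_row t1 t2 t3.
Proof. by rewrite /cubic_row; congr (nth 0 [:: _; _; _; _]); ring. Qed.

Lemma prod_linear_forms t1 t2 t3 (A B : {poly F}) :
  (t1%:P * A + B) * (t2%:P * A + B) * (t3%:P * A + B) =
  \sum_(k < 4) cubic_row t1 t2 t3 k *: (A ^+ (3 - k) * B ^+ k).
Proof.
rewrite !big_ord_recl big_ord0 /= /bump /= /cubic_row /= -!mul_polyC.
rewrite !(rmorphM, rmorphD) /=. rewrite /= !subSS !subn0 ?polyC1.
ring.
Qed.

Lemma coef_linear3 (a1 b1 a2 b2 a3 b3 : F) (k : 'I_4) :
  ((b1 *: 'X + a1%:P) * (b2 *: 'X + a2%:P) * (b3 *: 'X + a3%:P))`_k =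
  nth 0 [:: a1 * a2 * a3; a1 * a2 * b3 + a1 * b2 * a3 + b1 * a2 * a3;
      a1 * b2 * b3 + b1 * a2 * b3 + b1 * b2 * a3; b1 * b2 * b3] k.
Proof.
have -> : (b1 *: 'X + a1%:P) * (b2 *: 'X + a2%:P) * (b3 *: 'X + a3%:P) =
  Poly [:: a1 * a2 * a3; a1 * a2 * b3 + a1 * b2 * a3 + b1 * a2 * a3;
      a1 * b2 * b3 + b1 * a2 * b3 + b1 * b2 * a3; b1 * b2 * b3].
  rewrite /= !cons_poly_def -!mul_polyC !(rmorphM, rmorphD) /=; ring.
by rewrite coef_Poly.
Qed.

(** The determinant of the third symmetric power of a two by two matrix is the
    sixth power of its determinant. *)
Lemma det_cubic_basis (al be ga de : F) :
  \det (\matrix_(k < 4, m < 4)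
          ((be *: 'X + al%:P) ^+ (3 - k) * (de *: 'X + ga%:P) ^+ k)`_m) =
  (al * de - be * ga) ^+ 6.
Proof.
set M := (X in \det X).
pose f k m : F := nth (fun=> 0) [::
   fun m => nth 0 [:: al ^+ 3; 3 * al ^+ 2 * be; 3 * al * be ^+ 2; be ^+ 3] m;
   fun m => nth 0 [:: al ^+ 2 * ga; al ^+ 2 * de + 2 * al * be * ga;
                      2 * al * be * de + be ^+ 2 * ga; be ^+ 2 * de] m;
   fun m => nth 0 [:: al * ga ^+ 2; 2 * al * ga * de + be * ga ^+ 2;
                      al * de ^+ 2 + 2 * be * ga * de; be * de ^+ 2] m;
   fun m => nth 0 [:: ga ^+ 3; 3 * ga ^+ 2 * de; 3 * ga * de ^+ 2;
                      de ^+ 3] m] k m.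
have -> : M = \matrix_(k < 4, m < 4) f k m.
  apply/matrixP => k m; rewrite !mxE.
  case: k => [[|[|[|[|//]]]]] hk;
  rewrite /= ?expr0 ?expr1 ?mulr1 ?mul1r ?(exprS _ 2) ?(exprS _ 1) ?expr1;
  rewrite ?mulrA coef_linear3 {}/f /=;
  case: m => [[|[|[|[|//]]]]] hm /=; ring.
rewrite det_mx44 /det4 /f /=; ring.
Qed.
End Det4.

(** * The determinant of four concyclic points *)

Section Identity.
Variable F : fieldType.
Implicit Types p u : F.

(** With [p = e^(i A)] and [p' = e^(i B)] these are the quantities [q] and [w]
    attached to a triangle with angles [A], [B]; inverses replace complex
    conjugates, so that [det4_concyclic] is an identity in any field. *)
Definition excess p p' : F :=
  (p + p^-1) + (p' + p'^-1) - (p * p' + (p * p')^-1) - 2.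

Definition spread p p' : F :=
  6 + (p + p^-1) + (p' + p'^-1) + (p * p' + (p * p')^-1).

Lemma det4_scale_cubic (z a1 a2 a3 b1 b2 b3 c1 c2 c3 d1 d2 d3 : F) :
  det4 (cubic_row (z * a1) (z * a2) (z * a3))
       (cubic_row (z * b1) (z * b2) (z * b3))
       (cubic_row (z * c1) (z * c2) (z * c3))
       (cubic_row (z * d1) (z * d2) (z * d3)) =
  z ^+ 6 * det4 (cubic_row a1 a2 a3) (cubic_row b1 b2 b3)
                (cubic_row c1 c2 c3) (cubic_row d1 d2 d3).
Proof. rewrite /det4 /cubic_row /=; ring. Qed.

(** The numbers [p_k] are [e^(i A_k)], where [A_k] is half the arc from the
    point [k] to the next one in cyclic order; the sign in [p3]
    accounts for the half arcs having sum [pi]. *)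
Lemma det4_concyclic (u0 u1 u2 u3 : F) :
  u0 != 0 -> u1 != 0 -> u2 != 0 -> u3 != 0 ->
  let p0 := u1 / u0 in let p1 := u2 / u1 in
  let p2 := u3 / u2 in let p3 := - (u0 / u3) in
  det4 (cubic_row (u0 * u1) (u0 * u2) (u0 * u3))
       (cubic_row (- (u0 * u1)) (u1 * u2) (u1 * u3))
       (cubic_row (- (u0 * u2)) (- (u1 * u2)) (u2 * u3))
       (cubic_row (- (u0 * u3)) (- (u1 * u3)) (- (u2 * u3))) =
  (u0 * u1 * u2 * u3) ^+ 3 *
  (64 + excess p0 p1 * spread p0 p1 + excess p1 p2 * spread p1 p2
      + excess p2 p3 * spread p2 p3 + excess p3 p0 * spread p3 p0).
Proof.
move=> h0 h1 h2 h3; rewrite /= /excess /spread /det4 /cubic_row /=.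
by field; rewrite oppr_eq0 h0 h1 h2 h3.
Qed.
End Identity.

(** * Real inequalities *)

Section RealPart.
Variable R : realFieldType.

(** With [X = (8 + q1) (8 + q2)] and [Y = (8 + q3) (8 + q4)], one has
    [X Y <= ((X + Y) / 2) ^ 2]; the products [q1 q2] and
    [q3 q4] in [X + Y] are absorbed by the squares coming from
    [q w >= 4 q + q ^ 2]. *)
Lemma prod_le_sqr (q1 q2 q3 q4 w1 w2 w3 w4 : R) :
  0 <= q1 -> 0 <= q2 -> 0 <= q3 -> 0 <= q4 ->
  4 + q1 <= w1 -> 4 + q2 <= w2 -> 4 + q3 <= w3 -> 4 + q4 <= w4 ->
  (8 + q1) * (8 + q2) * (8 + q3) * (8 + q4) <=
  (64 + q1 * w1 + q2 * w2 + q3 * w3 + q4 * w4) ^+ 2.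
Proof.
move=> q1_ge0 q2_ge0 q3_ge0 q4_ge0 hw1 hw2 hw3 hw4.
pose Q := q1 + q2 + q3 + q4.
(* The arithmetic mean of [X] and [Y]. *)
pose m : R := 64 + 4 * Q + (q1 * q2 + q3 * q4) / 2.
have m_ge0 : 0 <= m.
  rewrite /m /Q; have := mulr_ge0 q1_ge0 q2_ge0.
  by have := mulr_ge0 q3_ge0 q4_ge0; lra.
apply: (@le_trans _ _ (m ^+ 2)).
  have := sqr_ge0 ((8 + q1) * (8 + q2) - (8 + q3) * (8 + q4)).
  rewrite /m /Q; lra.
have g (q w : R) : 0 <= q -> 4 + q <= w -> 4 * q + q ^+ 2 <= q * w.
  by move=> h h'; have := ler_wpM2l h h'; lra.
have h1 := g _ _ q1_ge0 hw1; have h2 := g _ _ q2_ge0 hw2.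
have h3 := g _ _ q3_ge0 hw3; have h4 := g _ _ q4_ge0 hw4.
have le_mS : m <= 64 + q1 * w1 + q2 * w2 + q3 * w3 + q4 * w4.
  have d1 := sqr_ge0 (q1 - q2); have d2 := sqr_ge0 (q3 - q4).
  have e1 := sqr_ge0 q1; have e2 := sqr_ge0 q2.
  have e3 := sqr_ge0 q3; have e4 := sqr_ge0 q4.
  by rewrite /m /Q; lra.
by rewrite ler_sqr ?nnegrE // (le_trans m_ge0).
Qed.

(** The rational parametrization of the circle by the tangent of the half
    angle. *)
Lemma half_angle (x y : R) : x ^+ 2 + y ^+ 2 = 1 -> -1 < x ->
  let t := y / (1 + x) in
  x = (1 - t ^+ 2) / (1 + t ^+ 2) /\ y = 2 * t / (1 + t ^+ 2).
Proof.
move=> h x_gt /=; have x1 : 0 < 1 + x by lra.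
have e : 1 + (y / (1 + x)) ^+ 2 = 2 / (1 + x).
  have -> : (y / (1 + x)) ^+ 2 = (1 - x ^+ 2) / (1 + x) ^+ 2.
    by rewrite expr_div_n -h; congr (_ / _); ring.
  by field; rewrite gt_eqF.
rewrite e; split; last by field; rewrite gt_eqF.
have -> : 1 - (y / (1 + x)) ^+ 2 = 2 - (1 + (y / (1 + x)) ^+ 2) by ring.
by rewrite e; field; rewrite gt_eqF.
Qed.

Lemma half_angle_gt0 (x y : R) : x ^+ 2 + y ^+ 2 = 1 -> 0 < y ->
  exists2 t, 0 < t &
    x = (1 - t ^+ 2) / (1 + t ^+ 2) /\ y = 2 * t / (1 + t ^+ 2).
Proof.
move=> h y_gt0; have x_gt : -1 < x by nra.
exists (y / (1 + x)); last exact: half_angle.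
by rewrite divr_gt0 //; lra.
Qed.

(** Here [(x, y)] and [(x', y')] are the cosines and sines of the angles [A] and
    [B].  With [t] and [s] the tangents of the half angles,
    [q = 8 s t (1 - s t) / ((1 + t ^ 2) (1 + s ^ 2))], and
    [1 - s t > 0] because the angles [A] and [B] have sum less than [pi]. *)
Lemma triangle_excess (x y x' y' : R) :
  x ^+ 2 + y ^+ 2 = 1 -> x' ^+ 2 + y' ^+ 2 = 1 ->
  0 < y -> 0 < y' -> 0 < x * y' + y * x' ->
  let q := 2 * (x + x' - (x * x' - y * y') - 1) in
  0 <= q /\ (forall rho : R,
    let a := rho * y in let b := rho * y' in let c := rho * (x * y' + y * x') in
    (a + b - c) * (b + c - a) * (c + a - b) = a * b * c * q).
Proof.
move=> h h' y_gt0 y'_gt0.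
have [t t_gt0 [-> ->]] := half_angle_gt0 h y_gt0.
have [s s_gt0 [-> ->]] := half_angle_gt0 h' y'_gt0.
have ht : 0 < 1 + t ^+ 2 by nra.
have hs : 0 < 1 + s ^+ 2 by nra.
have -> : (1 - t ^+ 2) / (1 + t ^+ 2) * (2 * s / (1 + s ^+ 2)) +
   2 * t / (1 + t ^+ 2) * ((1 - s ^+ 2) / (1 + s ^+ 2)) =
   2 * (s + t) * (1 - s * t) / ((1 + t ^+ 2) * (1 + s ^+ 2)).
  by field; rewrite !gt_eqF.
move=> hc.
have hst : 0 < 1 - s * t.
  have st : 0 < 2 * (s + t) by lra.
  have dgt0 := mulr_gt0 ht hs.
  by move: hc; rewrite ltr_pdivlMr // mul0r pmulr_rgt0.
set q := (X in let q := X in _).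
have eq : q = 8 * s * t * (1 - s * t) / ((1 + t ^+ 2) * (1 + s ^+ 2)).
  by rewrite /q; field; rewrite !gt_eqF.
split=> [|rho].
  by rewrite eq divr_ge0 ?mulr_ge0 // ltW.
by rewrite eq; field; rewrite !gt_eqF.
Qed.

End RealPart.

(** * The inequality for sorted points of a circle in the complex plane *)

Section Circle.
Variable R : realType.
Implicit Types (u v p z : R[i]) (rho : R).

Lemma sqr_normc_ReIm z : normc z ^+ 2 = complex.Re z ^+ 2 + complex.Im z ^+ 2.
Proof. by case: z => x y /=; rewrite sqr_sqrtr // addr_ge0 ?sqr_ge0. Qed.

Lemma mulcJ z : z * z^* = (normc z ^+ 2)%:C.
Proof.
rewrite sqr_normc_ReIm; case: z => x y; simpc => /=.
by congr Complex; ring.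
Qed.

Lemma normc_ge0 z : 0 <= normc z.
Proof. by case: z => x y /=; apply: sqrtr_ge0. Qed.

Lemma normc_real (r : R) : normc r%:C = `|r|.
Proof. by rewrite /= expr0n addr0 sqrtr_sqr. Qed.

Lemma normcX z n : normc (z ^+ n) = normc z ^+ n.
Proof.
elim: n => [|n IH]; first by rewrite !expr0 normc1.
by rewrite !exprS normcM IH.
Qed.

Lemma normc_opp z : normc (- z) = normc z.
Proof. exact: normcN. Qed.

Lemma normc_i : normc ('i : R[i]) = 1.
Proof. by rewrite /= expr0n add0r expr1n sqrtr1. Qed.

Lemma unit_neq0 u : normc u = 1 -> u != 0.
Proof.
by move=> hu; apply/eqP => u0; move/eqP: hu; rewrite u0 normc0 eq_sym oner_eq0.
Qed.

Lemma unit_invE u : normc u = 1 -> u^-1 = u^*.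
Proof.
move=> hu; apply: (mulfI (unit_neq0 hu)).
by rewrite mulfV ?unit_neq0 // mulcJ hu expr1n.
Qed.

Lemma unit_addV p : normc p = 1 -> p + p^-1 = (2 * complex.Re p)%:C.
Proof.
move=> /unit_invE ->; case: p => x y; simpc => /=.
by congr Complex; ring.
Qed.

Lemma unit_subV p : normc p = 1 -> p - p^-1 = (2 * complex.Im p)%:C * 'i.
Proof.
move=> /unit_invE ->; case: p => x y; simpc => /=.
by congr Complex; ring.
Qed.

Lemma unit_Im_oppV p : normc p = 1 -> complex.Im (- p^-1) = complex.Im p.
Proof. by move=> /unit_invE ->; case: p => x y /=; rewrite opprK. Qed.

Lemma unit_div u v : normc u = 1 -> normc v = 1 -> normc (u / v) = 1.
Proof. by move=> hu hv; rewrite normcM normcV hu hv invr1 mulr1. Qed.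

Definition chord (a b : R[i]) : R := normc (b - a).

Definition unit_dir (a b : R[i]) : R[i] := (b - a) / (chord a b)%:C.

Definition triangle_term (a b c : R) : R := d3 a b c + 8 * a * b * c.

Definition planar_det (z0 z1 z2 z3 : R[i]) : R[i] :=
  det4 (cubic_row (unit_dir z0 z1) (unit_dir z0 z2) (unit_dir z0 z3))
       (cubic_row (unit_dir z1 z0) (unit_dir z1 z2) (unit_dir z1 z3))
       (cubic_row (unit_dir z2 z0) (unit_dir z2 z1) (unit_dir z2 z3))
       (cubic_row (unit_dir z3 z0) (unit_dir z3 z1) (unit_dir z3 z2)).

(** The statement for four points of the complex plane, where the determinant
    only involves the unit directions between the points. *)
Definition planar_bound (z0 z1 z2 z3 : R[i]) : Prop :=
  triangle_term (chord z0 z1) (chord z0 z2) (chord z1 z2) *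
  triangle_term (chord z0 z1) (chord z0 z3) (chord z1 z3) *
  triangle_term (chord z0 z2) (chord z0 z3) (chord z2 z3) *
  triangle_term (chord z1 z2) (chord z1 z3) (chord z2 z3) <=
  (chord z0 z1 * chord z0 z2 * chord z0 z3 *
   chord z1 z2 * chord z1 z3 * chord z2 z3) ^+ 2 *
  normc (planar_det z0 z1 z2 z3) ^+ 2.

Lemma chordC a b : chord a b = chord b a.
Proof. by rewrite /chord -normc_opp opprB. Qed.

Lemma unit_dirC a b : unit_dir b a = - unit_dir a b.
Proof. by rewrite /unit_dir chordC -mulNr opprB. Qed.

Lemma planar_bound_swap01 z0 z1 z2 z3 :
  planar_bound z1 z0 z2 z3 -> planar_bound z0 z1 z2 z3.
Proof.
rewrite /planar_bound /planar_det det4_swap01 normc_opp.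
rewrite !(cubic_row_swap12 (unit_dir _ z1) (unit_dir _ z0)) (chordC z1 z0).
by rewrite /triangle_term /d3; congr (is_true (_ <= _ * _)); ring.
Qed.

Lemma planar_bound_swap12 z0 z1 z2 z3 :
  planar_bound z0 z2 z1 z3 -> planar_bound z0 z1 z2 z3.
Proof.
rewrite /planar_bound /planar_det det4_swap12 normc_opp.
rewrite (cubic_row_swap12 (unit_dir z0 z2)).
rewrite (cubic_row_swap23 (unit_dir z3 z0) (unit_dir z3 z2)).
rewrite (chordC z2 z1).
by rewrite /triangle_term /d3; congr (is_true (_ <= _ * _)); ring.
Qed.

Lemma planar_bound_swap23 z0 z1 z2 z3 :
  planar_bound z0 z1 z3 z2 -> planar_bound z0 z1 z2 z3.
Proof.
rewrite /planar_bound /planar_det det4_swap23 normc_opp.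
rewrite !(cubic_row_swap23 _ (unit_dir _ z3) (unit_dir _ z2)) (chordC z3 z2).
by rewrite /triangle_term /d3; congr (is_true (_ <= _ * _)); ring.
Qed.

(** [v ^ 2 - u ^ 2 = u v (v / u - u / v)], and the last factor is
    [2 i sin] of the angle from [u] to [v]: this is why square roots of the
    points are the right parameters. *)
Lemma sub_sqr_unit rho u v : normc u = 1 -> normc v = 1 ->
  rho%:C * v ^+ 2 - rho%:C * u ^+ 2 =
  (2 * rho * complex.Im (v / u))%:C * ('i * (u * v)).
Proof.
move=> hu hv; have hp := unit_div hv hu.
have := unit_subV hp; rewrite invf_div => e.
rewrite mulrAC rmorphM /= mulrAC.
have -> : rho%:C * v ^+ 2 - rho%:C * u ^+ 2 =
    rho%:C * (v / u - u / v) * (u * v).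
  by field; rewrite (unit_neq0 hu) (unit_neq0 hv).
rewrite e !rmorphM /=; ring.
Qed.

Lemma chord_circle rho u v : 0 < rho -> normc u = 1 -> normc v = 1 ->
  0 < complex.Im (v / u) ->
  chord (rho%:C * u ^+ 2) (rho%:C * v ^+ 2) = 2 * rho * complex.Im (v / u).
Proof.
move=> rho_gt0 hu hv him; rewrite /chord sub_sqr_unit // normcM normc_real.
rewrite !normcM normc_i hu hv !mulr1 ger0_norm //.
by rewrite ltW // !mulr_gt0.
Qed.

Lemma unit_dir_circle rho u v : 0 < rho -> normc u = 1 -> normc v = 1 ->
  0 < complex.Im (v / u) ->
  unit_dir (rho%:C * u ^+ 2) (rho%:C * v ^+ 2) = 'i * (u * v).
Proof.
move=> rho_gt0 hu hv him; rewrite /unit_dir chord_circle // sub_sqr_unit //.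
rewrite mulrAC mulfV ?mul1r //.
by rewrite fmorph_eq0 gt_eqF // !mulr_gt0.
Qed.

Definition arc_excess p p' : R :=
  2 * (complex.Re p + complex.Re p' - complex.Re (p * p') - 1).

Definition arc_spread p p' : R :=
  6 + 2 * (complex.Re p + complex.Re p' + complex.Re (p * p')).

Lemma excessE p p' : normc p = 1 -> normc p' = 1 ->
  excess p p' = (arc_excess p p')%:C.
Proof.
move=> hp hp'; have hpp : normc (p * p') = 1 by rewrite normcM hp hp' mulr1.
rewrite /excess !unit_addV // /arc_excess.
rewrite -!(rmorphD, rmorphB) -(rmorph_nat (real_complex R) 2) -rmorphB.
by congr (_%:C); ring.
Qed.

Lemma spreadE p p' : normc p = 1 -> normc p' = 1 ->
  spread p p' = (arc_spread p p')%:C.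
Proof.
move=> hp hp'; have hpp : normc (p * p') = 1 by rewrite normcM hp hp' mulr1.
have -> : spread p p' =
    6 + (p + p^-1) + (p' + p'^-1) + (p * p' + (p * p')^-1).
  by rewrite /spread !addrA.
rewrite !unit_addV // /arc_spread.
rewrite -(rmorph_nat (real_complex R) 6) -!rmorphD.
by congr (_%:C); ring.
Qed.

(** [c] is the side opposite to the angle [pi - A - B], by the sine rule. *)
Lemma arc_bounds p p' : normc p = 1 -> normc p' = 1 ->
  0 < complex.Im p -> 0 < complex.Im p' -> 0 < complex.Im (p * p') ->
  [/\ 0 <= arc_excess p p', 4 + arc_excess p p' <= arc_spread p p' &
    forall k, let a := k * complex.Im p in let b := k * complex.Im p' in
      let c := k * complex.Im (p * p') in
      triangle_term a b c = a * b * c * (8 + arc_excess p p')].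
Proof.
move=> hp hp'.
have : normc (p * p') ^+ 2 = 1 by rewrite normcM hp hp' mulr1 expr1n.
have : normc p ^+ 2 = 1 by rewrite hp expr1n.
have : normc p' ^+ 2 = 1 by rewrite hp' expr1n.
rewrite /arc_excess /arc_spread !sqr_normc_ReIm.
case: p hp => x y _; case: p' hp' => x' y' _ /= h' h hpp y0 y'0 c0.
have [q_ge0 hq] := triangle_excess h h' y0 y'0 c0.
split=> //.
  set X := x * x' - y * y' in hpp *.
  have X_ge : -1 <= X.
    have := sqr_ge0 (x * y' + y * x'); rewrite leNgt => hs.
    by apply/negP => X_lt; nra.
  lra.
move=> k; rewrite /triangle_term /d3 hq; ring.
Qed.

Lemma planar_bound_sorted rho u0 u1 u2 u3 : 0 < rho ->
  normc u0 = 1 -> normc u1 = 1 -> normc u2 = 1 -> normc u3 = 1 ->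
  0 < complex.Im (u1 / u0) -> 0 < complex.Im (u2 / u0) ->
  0 < complex.Im (u3 / u0) -> 0 < complex.Im (u2 / u1) ->
  0 < complex.Im (u3 / u1) -> 0 < complex.Im (u3 / u2) ->
  planar_bound (rho%:C * u0 ^+ 2) (rho%:C * u1 ^+ 2)
               (rho%:C * u2 ^+ 2) (rho%:C * u3 ^+ 2).
Proof.
move=> rho_gt0 n0 n1 n2 n3 h01 h02 h03 h12 h13 h23.
have z0 := unit_neq0 n0; have z1 := unit_neq0 n1.
have z2 := unit_neq0 n2; have z3 := unit_neq0 n3.
rewrite /planar_bound /planar_det.
pose z u := rho%:C * u ^+ 2; rewrite -!/(z _).
rewrite (unit_dirC (z u0) (z u1)) (unit_dirC (z u0) (z u2)).
rewrite (unit_dirC (z u0) (z u3)) (unit_dirC (z u1) (z u2)).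
rewrite (unit_dirC (z u1) (z u3)) (unit_dirC (z u2) (z u3)) /z.
rewrite !unit_dir_circle //.
rewrite -!(mulrN 'i) det4_scale_cubic det4_concyclic //.
rewrite !chord_circle //.
set p0 := u1 / u0; set p1 := u2 / u1; set p2 := u3 / u2; set p3 := - (u0 / u3).
have m0 : normc p0 = 1 by exact: unit_div.
have m1 : normc p1 = 1 by exact: unit_div.
have m2 : normc p2 = 1 by exact: unit_div.
have m3 : normc p3 = 1 by rewrite normc_opp unit_div.
have e01 : p0 * p1 = u2 / u0 by rewrite /p0 /p1; field; rewrite z0 z1.
have e12 : p1 * p2 = u3 / u1 by rewrite /p1 /p2; field; rewrite z1 z2.
have e23 : p2 * p3 = - (u2 / u0)^-1.
  by rewrite /p2 /p3; field; rewrite z0 z2 z3.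
have e30 : p3 * p0 = - (u3 / u1)^-1.
  by rewrite /p3 /p0; field; rewrite z0 z1 z3.
have ep3 : p3 = - (u3 / u0)^-1 by rewrite /p3 invf_div.
have i3 : complex.Im p3 = complex.Im (u3 / u0).
  by rewrite ep3 unit_Im_oppV // unit_div.
have i23 : complex.Im (p2 * p3) = complex.Im (u2 / u0).
  by rewrite e23 unit_Im_oppV // unit_div.
have i30 : complex.Im (p3 * p0) = complex.Im (u3 / u1).
  by rewrite e30 unit_Im_oppV // unit_div.
have [|q01 w01 T01] := arc_bounds m0 m1 h01 h12; first by rewrite e01.
have [|q12 w12 T12] := arc_bounds m1 m2 h12 h23; first by rewrite e12.
have [||q23 w23 T23] := arc_bounds m2 m3 h23; rewrite ?i3 ?i23 //.
have [||q30 w30 T30] := arc_bounds m3 m0 _ h01; rewrite ?i3 ?i30 //.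
rewrite !excessE // !spreadE //.
rewrite normcM (normcM (_ ^+ 3)) !normcX !normcM n0 n1 n2 n3 normc_i.
rewrite !mulr1 !expr1n !mul1r.
rewrite -(rmorph_nat (real_complex R) 64) -!rmorphM -!rmorphD normc_real.
rewrite real_normK ?num_real //.
have := prod_le_sqr q01 q12 q23 q30 w01 w12 w23 w30.
have := T01 (2 * rho); have := T12 (2 * rho).
have := T23 (2 * rho); have := T30 (2 * rho).
rewrite /= e01 e12 i3 i23 i30 -/p0 -/p1 -/p2 => {}T30 {}T23 {}T12 {}T01 le.
set r01 := 2 * rho * complex.Im p0 in T01 T30 *.
set r12 := 2 * rho * complex.Im p1 in T01 T12 *.
set r23 := 2 * rho * complex.Im p2 in T12 T23 *.
set r02 := 2 * rho * complex.Im (u2 / u0) in T01 T23 *.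
set r03 := 2 * rho * complex.Im (u3 / u0) in T23 T30 *.
set r13 := 2 * rho * complex.Im (u3 / u1) in T12 T30 *.
have -> : triangle_term r01 r02 r12 = triangle_term r01 r12 r02.
  by rewrite /triangle_term /d3; ring.
have -> : triangle_term r01 r03 r13 = triangle_term r03 r01 r13.
  by rewrite /triangle_term /d3; ring.
have -> : triangle_term r02 r03 r23 = triangle_term r23 r03 r02.
  by rewrite /triangle_term /d3; ring.
have -> : triangle_term r12 r13 r23 = triangle_term r12 r23 r13.
  by rewrite /triangle_term /d3; ring.
rewrite T01 T12 T23 T30.
set X := (X in X <= _).
set Y := (X in X ^+ 2 * _).
have -> : X = Y ^+ 2 * ((8 + arc_excess p0 p1) * (8 + arc_excess p1 p2) *
     (8 + arc_excess p2 p3) * (8 + arc_excess p3 p0)) by rewrite /X /Y; ring.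
by rewrite ler_wpM2l ?sqr_ge0.
Qed.

End Circle.

(** * Arbitrarily labelled points of a circle *)

(** On the half circle [y >= 0], [x > -1] the abscissa decreases with the angle;
    the conclusion says that the sine of the difference of angles is
    positive. *)
Lemma half_angle_lt (R : realFieldType) (x y x' y' : R) :
  x ^+ 2 + y ^+ 2 = 1 -> x' ^+ 2 + y' ^+ 2 = 1 ->
  -1 < x -> 0 <= y -> 0 <= y' -> -1 < x' -> x' < x -> 0 < x * y' - y * x'.
Proof.
move=> h h' x_gt y_ge0 y'_ge0 x'_gt.
have [ex ey] := half_angle h x_gt; have [ex' ey'] := half_angle h' x'_gt.
have t_ge0 : 0 <= y / (1 + x) by rewrite divr_ge0 //; lra.
have t'_ge0 : 0 <= y' / (1 + x') by rewrite divr_ge0 //; lra.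
move: (y / (1 + x)) (y' / (1 + x')) t_ge0 t'_ge0 ex ey ex' ey'.
move=> t t' t_ge0 t'_ge0 -> -> -> ->.
have dt : 0 < 1 + t ^+ 2 by nra.
have dt' : 0 < 1 + t' ^+ 2 by nra.
rewrite ltr_pdivrMr // mulrAC ltr_pdivlMr // => lt.
have tt' : 0 < t' - t by nra.
have -> : (1 - t ^+ 2) / (1 + t ^+ 2) * (2 * t' / (1 + t' ^+ 2)) -
     2 * t / (1 + t ^+ 2) * ((1 - t' ^+ 2) / (1 + t' ^+ 2)) =
   2 * ((t' - t) * (1 + t * t')) / ((1 + t ^+ 2) * (1 + t' ^+ 2)).
  by field; rewrite !gt_eqF.
rewrite divr_gt0 ?mulr_gt0 //.
by have := mulr_ge0 t_ge0 t'_ge0; lra.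
Qed.

Lemma sort4_ind (T : Type) (le : rel T) (P : T -> T -> T -> T -> Prop) :
  total le ->
  (forall a b c d, P b a c d -> P a b c d) ->
  (forall a b c d, P a c b d -> P a b c d) ->
  (forall a b c d, P a b d c -> P a b c d) ->
  (forall a b c d, le a b -> le b c -> le c d -> P a b c d) ->
  forall a b c d, P a b c d.
Proof.
move=> le_total s01 s12 s23 Psorted a b c d.
wlog cd : c d / le c d.
  by move=> W; case/orP: (le_total c d) => h; [|apply: s23]; apply: W.
wlog bc : b c d cd / le b c.
  move=> W; case/orP: (le_total b c) => bc; first exact: W.
  apply: s12; case/orP: (le_total b d) => bd; first exact: W.
  by apply: s23; apply: W.
case/orP: (le_total a b) => ab; first exact: Psorted.
apply: s01; case/orP: (le_total a c) => ac; first exact: Psorted.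
apply: s12; case/orP: (le_total a d) => ad; first exact: Psorted.
by apply: s23; apply: Psorted.
Qed.

Section CirclePoints.
Variable R : realType.
Implicit Types (u v z : R[i]) (rho : R).

Definition upper_arc u : bool :=
  [&& normc u == 1, 0 <= complex.Im u & -1 < complex.Re u].

(** Of the two square roots of a unit number exactly one lies on [upper_arc]. *)
Lemma upper_sqrt z : normc z = 1 -> exists2 u, upper_arc u & z = u ^+ 2.
Proof.
move=> hz; have hw2 := sqr_sqrtc z; set w := sqrtc z in hw2.
have hw : normc w = 1.
  apply/eqP; rewrite -(@eqrXn2 _ 2) ?normc_ge0 ?ler01 //.
  by rewrite expr1n -normcX hw2 hz.
have h : complex.Re w ^+ 2 + complex.Im w ^+ 2 = 1.
  by rewrite -sqr_normc_ReIm hw expr1n.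
case: (ltrgtP 0 (complex.Im w)) => him.
- exists w; rewrite // /upper_arc hw eqxx ltW //=; nra.
- exists (- w); last by rewrite sqrrN.
  rewrite /upper_arc normc_opp hw eqxx.
  by case: w {hw2 hw} h him => x y /= h him; apply/andP; split; nra.
- exists 1.
    by rewrite /upper_arc normc1 eqxx lexx /= (lt_trans _ ltr01) ?ltrN10.
  rewrite -hw2 expr1n; case: w {hw2 hw} h him => x y /= h y0.
  apply/eqP; rewrite eq_complex /= -y0 !mulr0 mul0r addr0 subr0 eqxx andbT.
  by rewrite -h -y0; apply/eqP; ring.
Qed.

Lemma upper_arc_lt u v : upper_arc u -> upper_arc v ->
  complex.Re v < complex.Re u -> 0 < complex.Im (v / u).
Proof.
case/and3P=> /eqP hu u1 u2 /and3P[/eqP hv v1 v2].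
rewrite unit_invE //.
have : normc u ^+ 2 = 1 by rewrite hu expr1n.
have : normc v ^+ 2 = 1 by rewrite hv expr1n.
rewrite !sqr_normc_ReIm; case: u {hu} u1 u2 => x y /= y0 x1.
case: v {hv} v1 v2 => x' y' /= y'0 x'1 h' h lt.
have := half_angle_lt h h' x1 y0 y'0 x'1 lt.
by congr (is_true (0 < _)); ring.
Qed.

Lemma upper_arc_Re_inj u v : upper_arc u -> upper_arc v ->
  complex.Re u = complex.Re v -> u = v.
Proof.
case/and3P=> /eqP hu u1 u2 /and3P[/eqP hv v1 v2] e.
have : normc u ^+ 2 = normc v ^+ 2 by rewrite hu hv.
rewrite !sqr_normc_ReIm e => /addrI /eqP.
rewrite eqrXn2 // => /eqP.
by case: u e {hu u1 u2} => x y; case: v {hv v1 v2} => x' y' /= -> ->.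
Qed.

Lemma planar_bound_concyclic rho z0 z1 z2 z3 : 0 < rho ->
  (forall z, z \in [:: z0; z1; z2; z3] -> normc z = rho) ->
  uniq [:: z0; z1; z2; z3] -> planar_bound z0 z1 z2 z3.
Proof.
move=> rho_gt0 hz.
have sq z : z \in [:: z0; z1; z2; z3] ->
    exists2 u, upper_arc u & z = rho%:C * u ^+ 2.
  have rho_neq0 : rho%:C != 0 :> R[i] by rewrite fmorph_eq0 gt_eqF.
  move=> /hz hzr; have [|u hu e] := @upper_sqrt (z / rho%:C).
    by rewrite normcM normcV normc_real gtr0_norm // hzr mulfV ?gt_eqF.
  by exists u; rewrite // -e mulrC divfK.
have [u0 h0 ->] : exists2 u, upper_arc u & z0 = rho%:C * u ^+ 2.
  by apply: sq; rewrite !inE eqxx ?orbT.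
have [u1 h1 ->] : exists2 u, upper_arc u & z1 = rho%:C * u ^+ 2.
  by apply: sq; rewrite !inE eqxx ?orbT.
have [u2 h2 ->] : exists2 u, upper_arc u & z2 = rho%:C * u ^+ 2.
  by apply: sq; rewrite !inE eqxx ?orbT.
have [u3 h3 ->] : exists2 u, upper_arc u & z3 = rho%:C * u ^+ 2.
  by apply: sq; rewrite !inE eqxx ?orbT.
pose z u := rho%:C * u ^+ 2; rewrite -!/(z _).
move=> huniq; have {huniq} : uniq [:: u0; u1; u2; u3].
  by apply: (@map_uniq _ _ z).
have : all upper_arc [:: u0; u1; u2; u3] by rewrite /= h0 h1 h2 h3.
pose P a b c d := all upper_arc [:: a; b; c; d] -> uniq [:: a; b; c; d] ->
  planar_bound (z a) (z b) (z c) (z d).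
rewrite -[_ -> _]/(P u0 u1 u2 u3) {sq hz h0 h1 h2 h3}.
apply: (@sort4_ind _ (fun a b => complex.Re b <= complex.Re a) P).
- by move=> a b; apply: le_total.
- move=> a b c d; have e : perm_eq [:: b; a; c; d] [:: a; b; c; d].
    exact/permPl/(perm_catCA [:: b] [:: a]).
  rewrite /P (perm_all _ e) (perm_uniq e) => H ? ?.
  exact/planar_bound_swap01/H.
- move=> a b c d; have e : perm_eq [:: a; c; b; d] [:: a; b; c; d].
    by rewrite perm_cons; apply/permPl/(perm_catCA [:: c] [:: b]).
  rewrite /P (perm_all _ e) (perm_uniq e) => H ? ?.
  exact/planar_bound_swap12/H.
- move=> a b c d; have e : perm_eq [:: a; b; d; c] [:: a; b; c; d].
    by rewrite !perm_cons; apply/permPl/(perm_catCA [:: d] [:: c]).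
  rewrite /P (perm_all _ e) (perm_uniq e) => H ? ?.
  exact/planar_bound_swap23/H.
move=> a b c d ab bc cd; rewrite /P /= !inE !negb_or.
case/and5P=> ha hb hc hd _; case/and4P=> /and3P[nab _ _] /andP[nbc _] ncd _.
have strict v w : upper_arc v -> upper_arc w -> v != w ->
    complex.Re w <= complex.Re v -> complex.Re w < complex.Re v.
  move=> hv hw nvw le; rewrite lt_neqAle le andbT.
  by apply: contra nvw => /eqP e; apply/eqP/esym/upper_arc_Re_inj.
have {nab}ab := strict _ _ ha hb nab ab.
have {nbc}bc := strict _ _ hb hc nbc bc.
have {ncd}cd := strict _ _ hc hd ncd cd.
have n v : upper_arc v -> normc v = 1 by case/and3P=> /eqP.
apply: planar_bound_sorted; rewrite ?n //; apply: upper_arc_lt => //; lra.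
Qed.

End CirclePoints.

(** * Spinors and the complex coordinate of a plane *)

Section Spinors.
Variable R : realType.
Implicit Types (z w al be : R[i]) (u v y m n : 'rV[R]_3).

Lemma natC2 : (2 : R[i]) = 2%:C.
Proof. by rewrite -(rmorph_nat (real_complex R) 2). Qed.

Lemma dotE u v : dot u v = u 0 (inord 0) * v 0 (inord 0) +
  u 0 (inord 1) * v 0 (inord 1) + u 0 (inord 2) * v 0 (inord 2).
Proof.
rewrite /dot !big_ord_recl big_ord0 addr0 addrA.
by congr (_ * _ + _ * _ + _ * _); congr (_ 0 _); apply: val_inj;
  rewrite /= inordK.
Qed.

Lemma dotBl u v n : dot (u - v) n = dot u n - dot v n.
Proof. rewrite !dotE !mxE; ring. Qed.

Lemma dotZl (k : R) u n : dot (k *: u) n = k * dot u n.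
Proof. rewrite !dotE !mxE; ring. Qed.

Lemma dotZr (k : R) u n : dot u (k *: n) = k * dot u n.
Proof. rewrite !dotE !mxE; ring. Qed.

Lemma dot_ge0 u : 0 <= dot u u.
Proof. by rewrite dotE !addr_ge0 // -expr2 sqr_ge0. Qed.

Lemma sqr_enorm u : enorm u ^+ 2 = dot u u.
Proof. by rewrite sqr_sqrtr ?dot_ge0. Qed.

Lemma enorm_eq0 u : (enorm u == 0) = (u == 0).
Proof.
apply/eqP/eqP => [h|->].
  have := sqr_enorm u; rewrite h expr0n /= dotE -!expr2 => /esym/eqP.
  rewrite !paddr_eq0 ?addr_ge0 ?sqr_ge0 // !sqrf_eq0.
  case/andP=> /andP[/eqP h0 /eqP h1] /eqP h2.
  apply/rowP => -[[|[|[|//]]] hk]; rewrite mxE.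
  - by rewrite -[RHS]h0; congr (u 0 _); apply: val_inj; rewrite /= inordK.
  - by rewrite -[RHS]h1; congr (u 0 _); apply: val_inj; rewrite /= inordK.
  - by rewrite -[RHS]h2; congr (u 0 _); apply: val_inj; rewrite /= inordK.
by rewrite /enorm dotE !mxE !mul0r !addr0 sqrtr0.
Qed.

(** The Hopf map is surjective.  Away from the south pole the first component
    can be chosen real and positive. *)
Lemma associated_surj v : dot v v = 1 -> exists z w, associated z w v.
Proof.
rewrite dotE -!expr2.
move E0: (v 0 (inord 0)) => v0; move E1: (v 0 (inord 1)) => v1.
move E2: (v 0 (inord 2)) => v2 h.
case: (ltP (-1) v2) => hv2.
  pose r := Num.sqrt ((1 + v2) / 2).
  have r2 : r ^+ 2 = (1 + v2) / 2 by rewrite sqr_sqrtr //; lra.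
  have r_gt0 : 0 < r by rewrite sqrtr_gt0; lra.
  pose w := (v0 / (2 * r)) -i* (v1 / (2 * r)).
  have hz : normc r%:C ^+ 2 = (1 + v2) / 2.
    by rewrite normc_real real_normK ?num_real.
  have hw : normc w ^+ 2 = (1 - v2) / 2.
    rewrite sqr_normc_ReIm /= sqrrN !expr_div_n exprMn r2 -mulrDl.
    have -> : v0 ^+ 2 + v1 ^+ 2 = 1 - v2 ^+ 2 by rewrite -h; ring.
    by field; rewrite gt_eqF //; lra.
  exists r%:C, w; split; rewrite ?E0 ?E1 ?E2 ?hz ?hw.
  - by field.
  - by rewrite /w; simpc => /=; field; rewrite gt_eqF.
  - by rewrite /w; simpc => /=; field; rewrite gt_eqF.
  - by field.
have v2E : v2 = -1 by nra.
have : v0 ^+ 2 + v1 ^+ 2 = 0 by move: h; rewrite v2E; lra.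
move/eqP; rewrite paddr_eq0 ?sqr_ge0 // !sqrf_eq0 => /andP[/eqP v00 /eqP v10].
exists 0, 1; split; rewrite ?E0 ?E1 ?E2 ?v00 ?v10 ?v2E ?mul0r ?normc0 ?normc1;
  by rewrite /=; ring.
Qed.

Lemma associated_antipode z w v :
  associated z w v -> associated (- w^*) (z^*) (- v).
Proof.
case: z w => [z1 z2] [w1 w2] [h h0 h1 h2].
split; rewrite ?mxE ?h0 ?h1 ?h2; move: h; rewrite !sqr_normc_ReIm;
  simpc => /= h; try ring.
by rewrite -h; ring.
Qed.

(** If [H] is the traceless Hermitian matrix of the vector [y] and [s] the
    spinor [(al, be)], this is the off-diagonal entry of [H] in the frame
    formed by [s] and its antipode [J s]. *)
Definition planar_coord al be y : R[i] :=
  (y 0 (inord 0) +i* y 0 (inord 1)) * al^* ^+ 2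
  - (y 0 (inord 0) -i* y 0 (inord 1)) * be^* ^+ 2
  - 2 * (y 0 (inord 2))%:C * (al^* * be^*).

Lemma planar_coordB al be u v :
  planar_coord al be (u - v) = planar_coord al be u - planar_coord al be v.
Proof.
rewrite /planar_coord !mxE.
have -> (a b c d : R) : (a - b) +i* (c - d) = (a +i* c) - (b +i* d) by [].
have -> (a b c d : R) : (a - b) -i* (c - d) = (a -i* c) - (b -i* d).
  by simpc; congr Complex; ring.
rewrite rmorphB; ring.
Qed.

Lemma planar_coordZ al be (k : R) u :
  planar_coord al be (k *: u) = k%:C * planar_coord al be u.
Proof.
rewrite /planar_coord !mxE.
have -> (a b : R) : (k * a) +i* (k * b) = k%:C * (a +i* b) by simpc.
have -> (a b : R) : (k * a) -i* (k * b) = k%:C * (a -i* b).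
  by simpc; congr Complex; ring.
rewrite rmorphM; ring.
Qed.

(** The diagonal entry of the same matrix in the frame is [dot y m], and the
    determinant of [H] is [- dot y y] in every frame. *)
Lemma normc_planar_coord al be m y : associated al be m -> dot y m = 0 ->
  normc (planar_coord al be y) = enorm y.
Proof.
case: al be => [a1 a2] [b1 b2] [h h0 h1 h2] hy.
apply/eqP; rewrite -(@eqrXn2 _ 2) ?normc_ge0 ?sqrtr_ge0 // sqr_enorm.
apply/eqP; rewrite sqr_normc_ReIm.
move: hy h; rewrite !dotE h0 h1 h2 !sqr_normc_ReIm /planar_coord.
move: (y 0 (inord 0)) (y 0 (inord 1)) (y 0 (inord 2)) => y0 y1 y2.
rewrite natC2 !expr2; simpc => /= hy h.
set N := (X in X = _) in h; set D := (X in X = 0) in hy.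
transitivity (N ^+ 2 * (y0 * y0 + y1 * y1 + y2 * y2) - D ^+ 2); last first.
  by rewrite h hy; ring.
rewrite /N /D; ring.
Qed.

(** [q] and [p] are the components of [(z, w)] in the frame.  The difference of
    their squared moduli is [dot y m = 0] and the sum is [1], while [2 p q^*] is
    the complex coordinate of [y]; hence [p = planar_coord al be y * q]. *)
Lemma frame_coords al be m z w y :
  associated al be m -> associated z w y -> dot y m = 0 ->
  let q := al * w - be * z in
  [/\ normc q ^+ 2 = 1 / 2,
      w = q * (planar_coord al be y * be + al^*) &
      z = q * (planar_coord al be y * al - be^*)].
Proof.
move=> am zy hy q.
have hq : normc q ^+ 2 = 1 / 2.
  have : 2 * normc q ^+ 2 = (normc al ^+ 2 + normc be ^+ 2) *
      (normc z ^+ 2 + normc w ^+ 2) - dot y m.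
    rewrite /q dotE; case: am => _ -> -> ->; case: zy => _ -> -> ->.
    rewrite !sqr_normc_ReIm.
    case: (al) (be) (z) (w) => [a1 a2] [b1 b2] [z1 z2] [w1 w2].
    by simpc => /=; ring.
  by case: am zy => -> _ _ _ [-> _ _ _]; rewrite hy; lra.
pose p := al^* * z + be^* * w.
have hp : planar_coord al be y * q = p.
  have -> : planar_coord al be y = 2 * p * q^*.
    case: zy => _ y0 y1 y2; rewrite /planar_coord y2 rmorphB /= -!mulcJ.
    have -> : (y 0 (inord 0) +i* y 0 (inord 1)) = 2 * (z * w^*).
      rewrite y0 y1 natC2.
      by case: (z * w^*) => ? ?; simpc.
    have -> : (y 0 (inord 0) -i* y 0 (inord 1)) = 2 * (z^* * w).
      rewrite y0 y1 natC2.
      by case: (z) (w) => [? ?] [? ?]; simpc => /=; congr Complex; ring.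
    rewrite /p /q rmorphB !rmorphM /=; ring.
  transitivity (2 * (q * q^*) * p); first by ring.
  by rewrite mulcJ hq natC2 -rmorphM mulrCA mulfV ?pnatr_eq0 // mulr1 mul1r.
have n1 : al * al^* + be * be^* = 1.
  by rewrite !mulcJ -rmorphD /=; case: am => -> _ _ _.
split=> //.
- rewrite mulrDr mulrA (mulrC q) hp /p /q.
  transitivity ((al * al^* + be * be^*) * w); last by ring.
  by rewrite n1 mul1r.
- rewrite mulrBr mulrA (mulrC q) hp /p /q.
  transitivity ((al * al^* + be * be^*) * z); last by ring.
  by rewrite n1 mul1r.
Qed.

End Spinors.

(** * Reduction of the Atiyah determinant to the plane *)

(* These are the terms that [big_ord_recl] produces. *)
Local Notation i0 := (ord0 : 'I_4).
Local Notation i1 := (lift ord0 ord0 : 'I_4).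
Local Notation i2 := (lift ord0 (lift ord0 ord0) : 'I_4).
Local Notation i3 := (lift ord0 (lift ord0 (lift ord0 ord0)) : 'I_4).

Lemma prod_others (S : comNzRingType) (f : 'I_4 -> S) i :
  \prod_(j < 4 | j != i) f j = \prod_(k < 3) f (lift i k).
Proof.
rewrite big_mkcond (bigD1_ord i) //= eqxx mul1r.
by apply: eq_bigr => k _; rewrite eq_sym neq_lift.
Qed.

Lemma prod_ord3 (S : comNzRingType) (f : 'I_3 -> S) :
  \prod_(k < 3) f k =
  f ord0 * f (lift ord0 ord0) * f (lift ord0 (lift ord0 ord0)).
Proof. by rewrite !big_ord_recl big_ord0 mulr1 mulrA. Qed.

Lemma prod_pairs (S : comNzRingType) (f : 'I_4 -> 'I_4 -> S) :
  \prod_(i < 4) \prod_(j < 4 | (i < j)%N) f i j =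
  f i0 i1 * f i0 i2 * f i0 i3 * f i1 i2 * f i1 i3 * f i2 i3.
Proof.
under eq_bigr => i _ do rewrite big_mkcond.
by rewrite !big_ord_recl !big_ord0 /= !mul1r !mulr1 !mulrA.
Qed.

Lemma prod_triples (S : comNzRingType) (f : 'I_4 -> 'I_4 -> 'I_4 -> S) :
  \prod_(i < 4) \prod_(j < 4 | (i < j)%N) \prod_(k < 4 | (j < k)%N) f i j k =
  f i0 i1 i2 * f i0 i1 i3 * f i0 i2 i3 * f i1 i2 i3.
Proof.
rewrite prod_pairs.
do !rewrite [\prod_(k < 4 | _) _]big_mkcond !big_ord_recl big_ord0 /=.
by rewrite ?mul1r ?mulr1 ?mulrA.
Qed.

Section Reduction.
Variable R : realType.
Implicit Types (al be : R[i]) (q t : 'I_4 -> 'I_4 -> R[i]).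

(** In the frame, [b 'X - a] becomes [q (t A + B)] with two fixed linear forms
    [A] and [B], so the coefficient matrix is the product of a diagonal matrix,
    the matrix in the numbers [t], and the matrix of the cubics in [A], [B],
    whose determinant is one. *)
Lemma det_atiyah_frame (a b : 'I_4 -> 'I_4 -> R[i]) al be q t :
  al * al^* + be * be^* = 1 ->
  (forall i j, i != j -> [/\ normc (q i j) ^+ 2 = 1 / 2,
     b i j = q i j * (t i j * be + al^*) &
     a i j = q i j * (t i j * al - be^*)]) ->
  normc (\det (\matrix_(i < 4, m < 4) (atiyah_poly a b i)`_m)) ^+ 2 =
  (1 / 2) ^+ 12 *
  normc (det4 (cubic_row (t i0 i1) (t i0 i2) (t i0 i3))
              (cubic_row (t i1 i0) (t i1 i2) (t i1 i3))
              (cubic_row (t i2 i0) (t i2 i1) (t i2 i3))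
              (cubic_row (t i3 i0) (t i3 i1) (t i3 i2))) ^+ 2.
Proof.
move=> n1 hab.
pose crow i := cubic_row (t i (lift i ord0)) (t i (lift i (lift ord0 ord0)))
  (t i (lift i (lift ord0 (lift ord0 ord0)))).
pose Q := \row_i \prod_(k < 3) q i (lift i k).
pose A : {poly R[i]} := be *: 'X + (- al)%:P.
pose B : {poly R[i]} := al^* *: 'X + (be^*)%:P.
set M := (\matrix_(i, m) _).
have -> : M = diag_mx Q *m (\matrix_(i < 4, k < 4) crow i k) *m
    (\matrix_(k < 4, m < 4) (A ^+ (3 - k) * B ^+ k)`_m).
  apply/matrixP => i m; rewrite mul_diag_mx !mxE /atiyah_poly prod_others.
  have -> : \prod_(k < 3) (b i (lift i k) *: 'X - (a i (lift i k))%:P) =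
      (\prod_(k < 3) q i (lift i k))%:P *
      \prod_(k < 3) ((t i (lift i k))%:P * A + B).
    rewrite rmorph_prod -big_split /=; apply: eq_bigr => k _.
    have [_ -> ->] := hab i (lift i k) (neq_lift i k).
    by rewrite /A /B -!mul_polyC !(rmorphM, rmorphD, rmorphN) /=; ring.
  rewrite (prod_ord3 (fun k => (t i (lift i k))%:P * A + B)) prod_linear_forms.
  rewrite mul_polyC coefZ coef_sum mulr_sumr; apply: eq_bigr => k _.
  by rewrite !mxE coefZ mulrA.
rewrite !det_mulmx det_diag det_cubic_basis.
have -> : - al * al^* - be * be^* = -1 by rewrite -n1; ring.
have -> : (-1) ^+ 6 = 1 :> R[i] by rewrite -signr_odd.
have -> : \det (\matrix_(i < 4, k < 4) crow i k) =
    det4 (crow i0) (crow i1) (crow i2) (crow i3).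
  transitivity (\det (\matrix_(i < 4, k < 4) crow (inord i) k)).
    by congr (\det _); apply/matrixP => i k; rewrite !mxE inord_val.
  rewrite (det_mx44 (fun i => crow (inord i))).
  have e0 : inord 0 = i0 by apply: val_inj; rewrite /= inordK.
  have e1 : inord 1 = i1 by apply: val_inj; rewrite /= inordK.
  have e2 : inord 2 = i2 by apply: val_inj; rewrite /= inordK.
  have e3 : inord 3 = i3 by apply: val_inj; rewrite /= inordK.
  by rewrite e0 e1 e2 e3.
have l10 : lift i1 ord0 = i0 by exact: val_inj.
have l11 : lift i1 (lift ord0 ord0) = i2 by exact: val_inj.
have l12 : lift i1 (lift ord0 (lift ord0 ord0)) = i3 by exact: val_inj.
have l20 : lift i2 ord0 = i0 by exact: val_inj.
have l21 : lift i2 (lift ord0 ord0) = i1 by exact: val_inj.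
have l22 : lift i2 (lift ord0 (lift ord0 ord0)) = i3 by exact: val_inj.
have l30 : lift i3 ord0 = i0 by exact: val_inj.
have l31 : lift i3 (lift ord0 ord0) = i1 by exact: val_inj.
have l32 : lift i3 (lift ord0 (lift ord0 ord0)) = i2 by exact: val_inj.
rewrite /crow l10 l11 l12 l20 l21 l22 l30 l31 l32 mulr1 normcM exprMn.
congr (_ * _); rewrite -normcX -prodrXl.
rewrite (big_morph _ (@normcM R) (@normc1 R)).
transitivity (\prod_(i < 4) (1 / 2 : R) ^+ 3).
  apply: eq_bigr => i _; rewrite mxE -prodrXl.
  rewrite (big_morph _ (@normcM R) (@normc1 R)).
  rewrite (eq_bigr (fun=> 1 / 2)) ?prodr_const ?card_ord // => k _.
  by rewrite normcX; have [->] := hab i (lift i k) (neq_lift i k).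
by rewrite prodr_const card_ord -exprM.
Qed.
End Reduction.

Theorem mainTheorem4 (R : realType) (x : 'I_4 -> 'rV[R]_3)
    (a b : 'I_4 -> 'I_4 -> R[i])
    (hx : cyclic_quadrilateral x) (hab : atiyah_choice x a b) :
  \prod_(i < 4) \prod_(j < 4 | (i < j)%N) \prod_(k < 4 | (j < k)%N)
     (d3 (dist x i j) (dist x i k) (dist x j k)
      + 8 * dist x i j * dist x i k * dist x j k)
  <= ComplexField.Normc.normc (atiyah_det x a b) ^+ 2.
Proof.
have [x_inj [c [n [rho [n_neq0 rho_gt0 hcirc]]]]] := hx.
have [al [be frame]] : exists al be, associated al be ((enorm n)^-1 *: n).
  apply: associated_surj.
  rewrite dotZl dotZr -sqr_enorm mulrA -expr2 -exprMn.
  by rewrite mulVf ?expr1n // enorm_eq0.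
pose xi i := planar_coord al be (x i - c).
have plane i : dot (x i - c) ((enorm n)^-1 *: n) = 0.
  by have [h _] := hcirc i; rewrite dotZr h mulr0.
have xiB i j : xi i - xi j = planar_coord al be (x i - x j).
  by rewrite -planar_coordB opprB addrA subrK.
have planeB i j : dot (x i - x j) ((enorm n)^-1 *: n) = 0.
  have <- : (x i - c) - (x j - c) = x i - x j by rewrite opprB addrA subrK.
  by rewrite dotBl !plane subrr.
have distE i j : dist x i j = chord (xi i) (xi j).
  by rewrite chordC /chord xiB (normc_planar_coord frame).
have dirC i j : dir x j i = - dir x i j.
  rewrite /dir -scalerN opprB -[enorm (x i - x j)]/(dist x i j).
  by rewrite -[enorm (x j - x i)]/(dist x j i) !distE chordC.
have hdir i j : planar_coord al be (dir x i j) = unit_dir (xi i) (xi j).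
  rewrite /dir planar_coordZ -xiB -[enorm _]/(dist x j i) distE chordC.
  by rewrite /unit_dir fmorphV mulrC.
have assoc i j : i != j -> associated (a i j) (b i j) (dir x i j).
  rewrite neq_ltn => /orP[] lt; first by have [] := hab i j lt.
  have [h -> ->] := hab j i lt.
  by rewrite dirC; apply: associated_antipode.
have n1 : al * al^* + be * be^* = 1.
  by rewrite !mulcJ -rmorphD /=; case: frame => ->.
have := @det_atiyah_frame R a b al be (fun i j => al * b i j - be * a i j)
  (fun i j => unit_dir (xi i) (xi j)) n1.
move=> Hdet.
rewrite prod_triples /atiyah_det normcM exprMn {}Hdet; last first.
  move=> i j /assoc hij; rewrite -hdir; apply: (frame_coords frame hij).
  by rewrite dotZl planeB mulr0.
rewrite normc_real real_normK ?num_real // prod_pairs.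
have : planar_bound (xi i0) (xi i1) (xi i2) (xi i3).
  have xi_inj : injective xi.
    move=> i j /eqP; rewrite -subr_eq0 xiB => /eqP e; apply: x_inj.
    apply/eqP; rewrite -subr_eq0 -enorm_eq0 -(normc_planar_coord frame) //.
    by rewrite e normc0.
  have hxi i : normc (xi i) = rho.
    by rewrite (normc_planar_coord frame) //; case: (hcirc i).
  apply: (planar_bound_concyclic rho_gt0).
    by move=> z; rewrite !inE => /or4P[] /eqP ->.
  by rewrite -[uniq _]/(uniq (map xi [:: i0; i1; i2; i3])) map_inj_uniq.
rewrite /planar_bound -/(planar_det (xi i0) (xi i1) (xi i2) (xi i3)) !distE.
rewrite /triangle_term; set D := normc _ ^+ 2.
move=> /le_trans; apply.
by rewrite le_eqVlt; apply/orP; left; apply/eqP; field.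
Qed.
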